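(* Let $X$ be a finite-dimensional normed space such that there exists a $(1,D,\tau_1,\tau_2,+\infty)$-threshold map from $X$ into a Hilbert space, for some $D>1$ and some $0<\tau_1<\tau_2$ with $\tau_2>8\tau_1$. Then there exists a map $h$ from $X$ into a Hilbert space such that for all $x_1,x_2\in X$, $$\left(\tau_2^{1/2}-(8\tau_1)^{1/2}\right)\cdot\min\left\{1,\frac{\|x_1-x_2\|}{2D+4}\right\}\le\|h(x_1)-h(x_2)\|\le(2\tau_1\|x_1-x_2\|)^{1/2}.$$ In particular, $h$ is a uniform embedding of $X$ into a Hilbert space with moduli depending only on $\tau_1,\tau_2$ and $D$.
   Context: A map $f:X\to Y$ between metric spaces is a $(s_1,s_2,\tau_1,\tau_2,+\infty)$-threshold map (for $0<s_1<s_2$, $0<\tau_1<\tau_2$) if for all $x_1,x_2\in X$: $d_X(x_1,x_2)\le s_1$ implies $d_Y(f(x_1),f(x_2))\le\tau_1$, and $d_X(x_1,x_2)\ge s_2$ implies $d_Y(f(x_1),f(x_2))\ge\tau_2$. A map $f:X\to Y$ is a uniform embedding if there are non-decreasing $L,U:\mathbb{R}_+\to\mathbb{R}_+$ with $L(d_X(x_1,x_2))\le d_Y(f(x_1),f(x_2))\le U(d_X(x_1,x_2))$ for all $x_1,x_2$, $U(t)\to0$ as $t\to0$, and $L(t)>0$ for all $t>0$; $L,U$ are the moduli. *)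

(* Defs.v *)
From HB Require Import structures.
From mathcomp Require Import all_boot all_order all_algebra.
From mathcomp Require Import sesquilinear.
From mathcomp Require Import all_classical all_reals all_analysis.
Set Implicit Arguments.
Unset Strict Implicit.
Unset Printing Implicit Defensive.
Import Order.TTheory GRing.Theory Num.Theory.
Import numFieldNormedType.Exports.
Local Open Scope classical_set_scope.
Local Open Scope ring_scope.

Definition norm_dist (R : realType) (V : normedModType R) (x y : V) : R :=
  `|x - y|.

Definition finite_dimensional (R : realType) (V : normedModType R) : Prop :=
  exists n : nat, inhabited (Vector.axiom n V).

(* Real Hilbert spaces; a complex Hilbert space is one too, for the real part
   of its inner product, with the same distance. *)
Definition is_hilbert (R : realType) (H : completeNormedModType R) : Prop :=
  exists dot : {dot H for idfun}, forall x : H, dot x x = `|x| ^+ 2.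

(* The case s3 = +oo of (s1, s2, tau1, tau2, s3)-threshold maps. The conditions
   0 < s1 < s2 and 0 < tau1 < tau2 are left to the user of the definition. *)
Definition threshold_map (R : realType) (X Y : Type)
    (dX : X -> X -> R) (dY : Y -> Y -> R) (s1 s2 tau1 tau2 : R)
    (f : X -> Y) : Prop :=
  (forall x1 x2, dX x1 x2 <= s1 -> dY (f x1) (f x2) <= tau1) /\
  (forall x1 x2, s2 <= dX x1 x2 -> tau2 <= dY (f x1) (f x2)).

(* Non-decreasing map from R_+ to R_+; values at negative reals are
   irrelevant. *)
Definition nondecreasing_Rplus (R : realType) (g : R -> R) : Prop :=
  (forall t, 0 <= t -> 0 <= g t) /\
  (forall s t, 0 <= s -> s <= t -> g s <= g t).

Definition uniform_embedding (R : realType) (X Y : Type)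
    (dX : X -> X -> R) (dY : Y -> Y -> R) (L U : R -> R)
    (f : X -> Y) : Prop :=
  [/\ nondecreasing_Rplus L,
      nondecreasing_Rplus U,
      forall x1 x2, L (dX x1 x2) <= dY (f x1) (f x2) <= U (dX x1 x2),
      U t @[t --> 0^'+] --> 0
    & forall t, 0 < t -> 0 < L t].

(* Main.v *)
(* The metric |f x - f y|^(1/2) is again Hilbertian (Schoenberg), so on a maximal
   1-separated set the threshold map yields a Hilbert-valued map g with
   |g x - g y|^2 <= 2 tau1 |x - y|; by Minty's theorem such a 1/2-Hoelder map extends
   with the same constant, and points at distance at least D + 2 stay at distance at
   least c = sqrt tau2 - 2 sqrt (2 tau1). This is done on finite sets only; the
   conditionally negative definite kernels |g x - g y|^2 then have an ultralimit on X,
   which is made translation invariant by averaging over larger and larger boxes. The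
   resulting kernel is |h x - h y|^2 for some h : X -> l^2, obtained by an infinite
   Cholesky factorization along a dense sequence of X. By invariance
   |h (x + n z) - h x| <= n |h (x + z) - h x|, so the lower bound c at distance D + 2
   gives a linear lower bound at smaller distances. *)
Require Import Defs.
From HB Require Import structures.
From mathcomp Require Import all_boot all_order all_algebra.
From mathcomp Require Import sesquilinear ring lra.
From mathcomp Require Import all_classical all_reals all_analysis.
Set Implicit Arguments.
Unset Strict Implicit.
Unset Printing Implicit Defensive.
Import Order.TTheory GRing.Theory Num.Theory.
Import numFieldNormedType.Exports.
Local Open Scope classical_set_scope.
Local Open Scope ring_scope.

(** * The Hilbert space l^2 *)

Lemma cvg_sum_seq (R : realType) (T I : Type) (F : set_system T) {FF : Filter F}
    (r : seq I) (P : pred I) (f : I -> T -> R) (a : I -> R) :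
  (forall i, P i -> f i x @[x --> F] --> a i) ->
  \sum_(i <- r | P i) f i x @[x --> F] --> \sum_(i <- r | P i) a i.
Proof. by move=> fa; apply: cvg_big => //; exact: add_continuous. Qed.

Section SquareSummable.
Context {R : realType}.

Definition sqsum : {pred (nat -> R)} :=
  fun f => `[< exists B, forall n, \sum_(k < n) f k ^+ 2 <= B >].

Lemma sqsum_submod_closed : submod_closed sqsum.
Proof.
split=> [|a f g /asboolP[A hA] /asboolP[B hB]].
  by apply/asboolP; exists 0 => n; rewrite big1// => i _; rewrite expr0n.
have le2 (x y : R) : (a * x + y) ^+ 2 <= 2 * a ^+ 2 * x ^+ 2 + 2 * y ^+ 2.
  by rewrite -subr_ge0 (_ : _ - _ = (a * x - y) ^+ 2) ?sqr_ge0//; ring.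
apply/asboolP; exists (2 * a ^+ 2 * A + 2 * B) => n.
apply: (@le_trans _ _ (\sum_(k < n) (2 * a ^+ 2 * f k ^+ 2 + 2 * g k ^+ 2))).
  by apply: ler_sum => k _; exact: le2.
rewrite big_split/= -!mulr_sumr.
have a0 : 0 <= 2 * a ^+ 2 by apply: mulr_ge0; [exact: ler0n|exact: sqr_ge0].
by apply: lerD; apply: ler_wpM2l; [|exact: hA|exact: ler0n|exact: hB].
Qed.
HB.instance Definition _ :=
  GRing.isSubmodClosed.Build _ _ sqsum sqsum_submod_closed.

Record l2 := L2 { l2val :> nat -> R; l2valP : l2val \in sqsum }.
HB.instance Definition _ := [isSub for l2val].
HB.instance Definition _ := [Choice of l2 by <:].
HB.instance Definition _ := [SubChoice_isSubLmodule of l2 by <:].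

End SquareSummable.
Arguments l2 : clear implicits.

Section L2Dot.
Context {R : realType}.
Implicit Types f g h : l2 R.

Definition psum (f g : nat -> R) (n : nat) : R := \sum_(k < n) f k * g k.

Definition l2dot f g : R := limn (psum f g).

Lemma psum_diag_nondecreasing (f : nat -> R) : nondecreasing_seq (psum f f).
Proof.
by apply/nondecreasing_seqP => n; rewrite /psum big_ord_recr/= lerDl -expr2 sqr_ge0.
Qed.

Lemma cvg_psum_diag f : cvgn (psum f f).
Proof.
have /asboolP[B hB] := l2valP f.
apply: nondecreasing_is_cvgn; first exact: psum_diag_nondecreasing.
by exists B => _ [n _ <-]; rewrite (le_trans _ (hB n))// ler_sum.
Qed.

(** Polarization reduces the convergence to the diagonal case, where the partial sums are
    non-decreasing and bounded. *)
Lemma cvg_psum f g : psum f g @ \oo --> l2dot f g.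
Proof.
suff : cvgn (psum f g) by [].
have -> : psum f g = 4^-1 \*o (psum (f + g) (f + g) - psum (f - g) (f - g)).
  apply/funext => n; rewrite /psum /= !fctE -sumrB mulr_sumr; apply: eq_bigr => k _.
  by field.
by apply: is_cvgMr; apply: is_cvgB; exact: cvg_psum_diag.
Qed.

Lemma l2dotC f g : l2dot f g = l2dot g f.
Proof. by congr (limn _); apply/funext => n; apply: eq_bigr => k _; rewrite mulrC. Qed.

Lemma l2dot_linear g : scalar (l2dot^~ g).
Proof.
move=> a f h; apply: (@cvg_lim R) => //.
have -> : psum (a *: f + h) g = a \*o psum f g + psum h g.
  apply/funext => n; rewrite /psum /= !fctE /= mulr_sumr -big_split; apply: eq_bigr => k _.
  by rewrite mulrDl mulrA.
by apply: cvgD; [apply: cvgMr|]; exact: cvg_psum.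
Qed.

Lemma psum_le_l2dot f n : psum f f n <= l2dot f f.
Proof.
exact: nondecreasing_cvgn_le (psum_diag_nondecreasing f) (@cvg_psum_diag f) n.
Qed.

Lemma l2dot_le f (B : R) : (forall n, psum f f n <= B) -> l2dot f f <= B.
Proof.
by move=> fB; apply: limr_le; [exact: cvg_psum_diag|exact: nearW].
Qed.

Lemma l2dot_gt0 f : f != 0 -> 0 < l2dot f f.
Proof.
apply: contra_neqT; rewrite -leNgt => f0; apply/val_inj/funext => k /=.
apply/eqP; rewrite -sqrf_eq0 eq_le sqr_ge0 andbT.
apply: le_trans (le_trans (psum_le_l2dot f k.+1) f0).
by rewrite /psum big_ord_recr/= -expr2 lerDr sumr_ge0// => i _; rewrite -expr2 sqr_ge0.
Qed.

Lemma l2dot_bilinear : bilinear_for *%R (idfun \; *%R) l2dot.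
Proof.
by split=> [g|f] a x y; rewrite ?(l2dotC f) l2dot_linear//= !(l2dotC f).
Qed.

HB.instance Definition _ :=
  bilinear_isBilinear.Build R (l2 R) (l2 R) R *%R (idfun \; *%R) l2dot l2dot_bilinear.
Lemma l2dot_herm f g : l2dot f g = (-1) ^+ false * idfun (l2dot g f).
Proof. by rewrite mul1r l2dotC. Qed.
HB.instance Definition _ :=
  isHermitianSesquilinear.Build R (l2 R) false idfun l2dot l2dot_herm.
HB.instance Definition _ := isDotProduct.Build R (l2 R) l2dot l2dot_gt0.

Lemma l2dotDl f g h : l2dot (f + g) h = l2dot f h + l2dot g h.
Proof. exact: linearDl. Qed.
Lemma l2dotZl a f h : l2dot (a *: f) h = a * l2dot f h.
Proof. exact: linearZl. Qed.
Lemma l2dotDr f g h : l2dot h (f + g) = l2dot h f + l2dot h g.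
Proof. exact: linearDr. Qed.
Lemma l2dotZr a f h : l2dot h (a *: f) = a * l2dot h f.
Proof. exact: linearZr. Qed.

Lemma l2dot0l h : l2dot 0 h = 0.
Proof. exact: linear0l. Qed.

Lemma l2dot_ge0 f : 0 <= l2dot f f.
Proof.
have [->|/l2dot_gt0/ltW//] := eqVneq f 0.
by rewrite l2dot0l.
Qed.

Definition l2norm f : R := Num.sqrt (l2dot f f).

Lemma l2norm_sqr f : l2norm f ^+ 2 = l2dot f f.
Proof. by rewrite sqr_sqrtr// l2dot_ge0. Qed.

Lemma l2norm_eq0 f : l2norm f = 0 -> f = 0.
Proof.
move=> f0; apply/eqP; apply: contra_eqT f0 => /l2dot_gt0.
by rewrite -sqrtr_gt0 => /gt_eqF->.
Qed.

Lemma l2dot_le_norm f g : l2dot f g <= l2norm f * l2norm g.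
Proof.
have [/l2norm_eq0->|f0] := eqVneq (l2norm f) 0.
  by rewrite l2dot0l mulr_ge0// sqrtr_ge0.
have [/l2norm_eq0->|g0] := eqVneq (l2norm g) 0.
  by rewrite l2dotC l2dot0l mulr_ge0// sqrtr_ge0.
have fg0 : 0 < l2norm f * l2norm g.
  by rewrite mulr_gt0// lt_neqAle sqrtr_ge0 andbT eq_sym.
(* Cauchy-Schwarz: this square is [2 a b (a b - c)] with [a], [b] the norms and [c] the inner
   product. *)
have := l2dot_ge0 (l2norm g *: f + (- l2norm f) *: g).
rewrite !(l2dotDl, l2dotDr, l2dotZl, l2dotZr) -!l2norm_sqr (l2dotC g).
move: fg0; set a := l2norm f; set b := l2norm g; set c := l2dot f g => fg0 h0.
by rewrite -(ler_pM2l fg0); lra.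
Qed.

Lemma l2norm_triangle f g : l2norm (f + g) <= l2norm f + l2norm g.
Proof.
rewrite -(@ler_pXn2r _ 2)// ?nnegrE ?addr_ge0 ?sqrtr_ge0//.
rewrite l2norm_sqr !(l2dotDl, l2dotDr) (l2dotC g) -!l2norm_sqr.
by have := l2dot_le_norm f g; lra.
Qed.

Lemma l2normZ (a : R) f : l2norm (a *: f) = `|a| * l2norm f.
Proof.
by rewrite /l2norm l2dotZl l2dotZr mulrA -expr2 sqrtrM ?sqr_ge0// sqrtr_sqr.
Qed.

HB.instance Definition _ :=
  Lmodule_isNormed.Build R (l2 R) l2norm_triangle l2normZ l2norm_eq0.

Lemma l2normE f : `|f| = l2norm f. Proof. by []. Qed.

Lemma l2_coord_le f k : `|f k| <= `|f|.
Proof.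
rewrite -(@ler_pXn2r _ 2)// ?nnegrE// l2normE l2norm_sqr real_normK ?num_real//.
apply: le_trans (psum_le_l2dot f k.+1).
by rewrite /psum big_ord_recr/= -expr2 lerDr sumr_ge0// => i _; rewrite -expr2 sqr_ge0.
Qed.

(** The limit is taken coordinatewise. For fixed [n] the Cauchy bound on the first [n] coordinates
    passes to the limit; being uniform in [n], it gives both square summability and convergence in
    norm. *)
Lemma l2_complete (F : set_system (l2 R)) : ProperFilter F -> cauchy F -> cvg F.
Proof.
move=> FF Fc.
have coord_cvg k : cvg ((fun f : l2 R => f k) @ F).
  apply: cauchy_cvg; apply/cauchy_exP => e e0.
  have [f Ff] := (cauchyP F).1 Fc e e0.
  exists (f k); apply: (@filterS _ F _ (ball f e)) => // g; rewrite -!ball_normE/= => fg.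
  by apply: le_lt_trans fg; exact: (l2_coord_le (f - g) k).
pose l k := lim ((fun f : l2 R => f k) @ F).
have tail e : 0 < e -> \forall g \near F, forall n, psum (l2val g \- l) (l2val g \- l) n <= e ^+ 2.
  move=> e0; have [f Ff] := (cauchyP F).1 Fc (e / 2) (divr_gt0 e0 (ltr0Sn _ 1)).
  apply: (filterS _ Ff) => g; rewrite -ball_normE/= => fg n.
  have : (fun h : l2 R => psum (g \- h) (g \- h) n) @ F --> psum (g \- l) (g \- l) n.
    apply: cvg_sum_seq => k _.
    by apply: cvgM; apply: cvgB; (exact: cvg_cst || exact: coord_cvg).
  move/cvgr_to_le; apply; apply: filterS Ff => h; rewrite -ball_normE/= => fh.
  have gh : `|g - h| <= e.
    rewrite (_ : g - h = (f - h) - (f - g)); last by rewrite opprB [RHS]addrC subrKA.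
    by rewrite (le_trans (ler_normB _ _))// (splitr e) lerD// ltW.
  apply: (le_trans (psum_le_l2dot (g - h) n)).
  by rewrite -l2norm_sqr -l2normE ler_pXn2r// ?nnegrE// ltW.
have lP : (l : nat -> R) \in sqsum.
  have [g hg] := filter_ex (tail 1 ltr01).
  have gl : (g \- l : nat -> R) \in sqsum.
    by apply/asboolP; exists (1 ^+ 2) => n; apply: le_trans (hg n); apply: ler_sum.
  have -> : l = (- 1) *: (g \- l : nat -> R) + g.
    by apply/funext => k; change (l k = - 1 * (g k - l k) + g k); ring.
  have [_ hl] := @sqsum_submod_closed R.
  exact: (hl _ _ _ gl (l2valP g)).
apply/cvg_ex; exists (L2 lP); apply/cvgrPdist_le => /= e e0.
apply: (filterS _ (tail e e0)) => g hg; rewrite distrC.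
rewrite -(@ler_pXn2r _ 2)// ?nnegrE ?(ltW e0)//.
apply: (@le_trans _ _ (l2dot (g - L2 lP) (g - L2 lP))); last exact: l2dot_le.
by rewrite -l2norm_sqr.
Qed.

HB.instance Definition _ := Uniform_isComplete.Build (l2 R) l2_complete.

Lemma l2dotE f : l2dot f f = `|f| ^+ 2.
Proof. by rewrite l2normE l2norm_sqr. Qed.

Lemma l2_hilbert : is_hilbert (l2 R : completeNormedModType R).
Proof. by exists l2dot; exact: l2dotE. Qed.
End L2Dot.

(** * Positive semidefinite kernels *)

Section Kernels.
Context {R : realType} {I : eqType}.
Implicit Types (K L : I -> I -> R) (s : seq (R * I)) (x y p q : I).

(** A list of weighted points stands for a finitely supported signed measure, repetitions allowed:
    [quad K s] is its energy and [lin K s x] its potential at [x]. *)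
Definition quad K s : R := \sum_(a <- s) \sum_(b <- s) a.1 * b.1 * K a.2 b.2.

Definition lin K s x : R := \sum_(a <- s) a.1 * K a.2 x.

Definition psd K := (forall x y, K x y = K y x) /\ forall s, 0 <= quad K s.

Lemma quad_cons K c x s : (forall x y, K x y = K y x) ->
  quad K ((c, x) :: s) = c ^+ 2 * K x x + 2 * c * lin K s x + quad K s.
Proof.
move=> Ksym; rewrite /quad /lin big_cons/= big_cons/=.
under [X in _ + X = _]eq_bigr do rewrite big_cons/=.
rewrite big_split/= addrA -[in RHS]mulrA mulr2n mulrDl mul1r mulr_sumr -addrA.
rewrite addrA expr2; congr (_ + _); rewrite -!addrA; congr (_ + (_ + _)).
  by apply: eq_bigr => a _; rewrite Ksym; ring.
by apply: eq_bigr => a _; ring.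
Qed.

Lemma quad_nil K : quad K [::] = 0. Proof. by rewrite /quad big_nil. Qed.

Lemma quad_pair K a x b y : (forall x y, K x y = K y x) ->
  quad K [:: (a, x); (b, y)] = a ^+ 2 * K x x + 2 * a * b * K x y + b ^+ 2 * K y y.
Proof.
move=> Ksym; rewrite !quad_cons// quad_nil /lin !big_cons !big_nil/= (Ksym y).
by ring.
Qed.

Lemma quad_mulw K (f : I -> R) s :
  quad (fun x y => f x * f y * K x y) s = quad K [seq (a.1 * f a.2, a.2) | a <- s].
Proof.
rewrite /quad big_map; apply: eq_bigr => a _; rewrite big_map.
by apply: eq_bigr => b _ /=; ring.
Qed.

Lemma quadD K L s : quad (fun x y => K x y + L x y) s = quad K s + quad L s.
Proof.
rewrite /quad -big_split; apply: eq_bigr => a _; rewrite -big_split.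
by apply: eq_bigr => b _ /=; rewrite mulrDr.
Qed.

Lemma quadZ K (c : R) s : quad (fun x y => c * K x y) s = c * quad K s.
Proof.
rewrite /quad mulr_sumr; apply: eq_bigr => a _; rewrite mulr_sumr.
by apply: eq_bigr => b _ /=; ring.
Qed.

Lemma quad_rank1 (f : I -> R) s :
  quad (fun x y => f x * f y) s = (\sum_(a <- s) a.1 * f a.2) ^+ 2.
Proof.
rewrite expr2 mulr_suml; apply: eq_bigr => a _; rewrite mulr_sumr.
by apply: eq_bigr => b _ /=; ring.
Qed.

Lemma quad_sum (f : I -> R) s :
  quad (fun x y => f x + f y) s = 2 * (\sum_(a <- s) a.1) * \sum_(a <- s) a.1 * f a.2.
Proof.
rewrite quadD mulr2n mulrDl mul1r mulrDl; congr (_ + _).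
  rewrite mulrC mulr_suml; apply: eq_bigr => a _.
  by rewrite mulr_sumr; apply: eq_bigr => b _; ring.
rewrite mulr_suml; apply: eq_bigr => a _.
by rewrite mulr_sumr; apply: eq_bigr => b _; ring.
Qed.

Lemma cvg_quad (T : Type) (F : set_system T) {FF : Filter F} (Kn : T -> I -> I -> R)
    K s : (forall x y, Kn t x y @[t --> F] --> K x y) ->
  quad (Kn t) s @[t --> F] --> quad K s.
Proof.
move=> KnK; apply: cvg_sum_seq => a _; apply: cvg_sum_seq => b _.
by apply: cvgM; [exact: cvg_cst|exact: KnK].
Qed.

Lemma psdD K L : psd K -> psd L -> psd (fun x y => K x y + L x y).
Proof.
move=> [Ks K0] [Ls L0]; split=> [x y|s]; first by rewrite Ks Ls.
by rewrite quadD addr_ge0.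
Qed.

Lemma psdZ K (c : R) : 0 <= c -> psd K -> psd (fun x y => c * K x y).
Proof.
move=> c0 [Ks K0]; split=> [x y|s]; first by rewrite Ks.
by rewrite quadZ mulr_ge0.
Qed.

Lemma psd_rank1 (f : I -> R) : psd (fun x y => f x * f y).
Proof. by split=> [x y|s]; [rewrite mulrC|rewrite quad_rank1 sqr_ge0]. Qed.

Lemma psd_mulw K (f : I -> R) : psd K -> psd (fun x y => f x * f y * K x y).
Proof.
by move=> [Ks K0]; split=> [x y|s]; [rewrite Ks (mulrC (f x))|rewrite quad_mulw].
Qed.

Lemma psd_lim (Kn : nat -> I -> I -> R) K : (forall n, psd (Kn n)) ->
  (forall x y, Kn n x y @[n --> \oo] --> K x y) -> psd K.
Proof.
move=> Knpsd KnK; split=> [x y|s].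
  apply: (cvg_unique (@Rhausdorff R) (KnK x y)).
  rewrite (_ : (fun n => Kn n x y) = fun n => Kn n y x); first exact: KnK.
  by apply/funext => n; have [->] := Knpsd n.
have Kns := @cvg_quad _ _ _ Kn K s KnK.
by apply: (cvgr_to_ge (Kns _)); apply: nearW => n; have [_ Kn0] := Knpsd n; exact: Kn0.
Qed.

Lemma psd_diag_ge0 K x : psd K -> 0 <= K x x.
Proof.
move=> [Ks K0]; have := K0 [:: (1, x)]; rewrite quad_cons// quad_nil /lin big_nil.
by rewrite expr1n mul1r mulr0 !addr0.
Qed.

Lemma psd_diag0 K x y : psd K -> K x x = 0 -> K x y = 0.
Proof.
move=> [Ks K0] Kx0; apply/eqP; apply: contraT => Kxy0.
(* As [K x x = 0], the form is affine in the weight of [x]; this weight brings it to [-1]. *)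
have := K0 [:: (- (K y y + 1) / (2 * K x y), x); (1, y)].
by rewrite quad_pair// Kx0 (_ : _ + _ = - 1) ?oppr_ge0 ?ler10//; field.
Qed.

Lemma psd_pair_le K x y : psd K ->
  K x x - 2 * K x y + K y y <= 2 * K x x + 2 * K y y.
Proof.
move=> [Ks K0]; have := K0 [:: (1, x); (1, y)].
by rewrite quad_pair//; lra.
Qed.

(* When [K p p = 0], division by zero makes [pivot p K = K], which is right since
   then [K p] vanishes. *)
Definition pivot p K x y : R := K x y - K x p * K p y / K p p.

Lemma quad_pivot p K s : (forall x y, K x y = K y x) ->
  quad (pivot p K) s = quad K s - lin K s p ^+ 2 / K p p.
Proof.
move=> Ksym; rewrite -(quad_rank1 (K ^~ p)) mulrC -mulNr -quadZ -quadD.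
by apply: eq_bigr => a _; apply: eq_bigr => b _; rewrite /pivot (Ksym p); congr (_ * _); ring.
Qed.

Lemma quad_pivot_le p K s : psd K -> quad (pivot p K) s <= quad K s.
Proof.
move=> Kpsd; rewrite quad_pivot; last by case: Kpsd.
by rewrite gerBl divr_ge0 ?sqr_ge0// psd_diag_ge0.
Qed.

(** The Schur complement at [p] is the minimum of the form over the weight put on [p], attained at
    [- lin K s p / K p p]. *)
Lemma psd_pivot p K : psd K -> psd (pivot p K).
Proof.
move=> [Ks K0]; split=> [x y|s].
  by rewrite /pivot (Ks x) (Ks y p) (Ks x p) [_ * K p y]mulrC.
rewrite quad_pivot//; have := K0 ((- lin K s p / K p p, p) :: s).
rewrite quad_cons//; have [->|Kp0] := eqVneq (K p p) 0.
  by rewrite invr0 !mulr0 !mul0r !add0r subr0.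
by congr (0 <= _); field.
Qed.

Lemma pivot_self p K y : psd K -> pivot p K p y = 0.
Proof.
move=> Kpsd; rewrite /pivot; have [Kp0|Kp0] := eqVneq (K p p) 0.
  by rewrite Kp0 invr0 mulr0 subr0 psd_diag0.
by field.
Qed.

Lemma pivot0 p K q : (forall y, K q y = 0) -> forall y, pivot p K q y = 0.
Proof. by move=> Kq0 y; rewrite /pivot !Kq0 !mul0r subr0. Qed.

Definition pivots (ps : seq I) K := foldr pivot K ps.

Lemma psd_pivots ps K : psd K -> psd (pivots ps K).
Proof. by move=> Kpsd; elim: ps => //= p ps; exact: psd_pivot. Qed.

Lemma pivots_mem ps K p y : psd K -> p \in ps -> pivots ps K p y = 0.
Proof.
move=> Kpsd; elim: ps y => //= q ps IH y; rewrite inE => /predU1P[->|pps].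
  by apply: pivot_self; exact: psd_pivots.
by apply: pivot0 => z; exact: IH.
Qed.

(** Schur product theorem by elimination. A pivot on [K] removes a rank-one term whose product with
    [L] is still positive semidefinite, so the form can only decrease; after a pivot at every point
    of [s] it is zero. *)
Lemma psd_schur K L : psd K -> psd L -> psd (fun x y => K x y * L x y).
Proof.
move=> Kpsd Lpsd; have [[Ks _] [Ls L0]] := (Kpsd, Lpsd).
split=> [x y|s]; first by rewrite Ks Ls.
have le_pivots ps : quad (fun x y => pivots ps K x y * L x y) s <=
    quad (fun x y => K x y * L x y) s.
  elim: ps => //= p ps; apply: le_trans; rewrite -subr_ge0.
  have := psd_pivots ps Kpsd; set M := pivots ps K => Mpsd.
  have [Ms _] := Mpsd.
  have := L0 [seq (a.1 * M a.2 p, a.2) | a <- s]; rewrite -(quad_mulw L (M^~ p)).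
  have Mp0 : 0 <= (M p p)^-1 by rewrite invr_ge0 psd_diag_ge0.
  move=> /(mulr_ge0 Mp0); rewrite -quadZ; congr (0 <= _).
  rewrite -mulN1r -quadZ -quadD; apply: eq_bigr => a _; apply: eq_bigr => b _.
  by rewrite /pivot (Ms p); congr (_ * _); ring.
apply: le_trans (le_pivots (map snd s)).
rewrite /quad big_seq sumr_ge0// => a sa; rewrite sumr_ge0// => b _.
by rewrite pivots_mem ?map_f// mul0r mulr0.
Qed.

(** * Infinite Cholesky factorization of a kernel *)

Section Realize.
Variables (K : I -> I -> R) (d : nat -> I).
Hypothesis Kpsd : psd K.

Fixpoint pivotn n : I -> I -> R :=
  if n is m.+1 then pivot (d m) (pivotn m) else K.

Lemma psd_pivotn n : psd (pivotn n).
Proof. by elim: n => //= n; exact: psd_pivot. Qed.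

Lemma quad_pivotn_le n s : quad (pivotn n) s <= quad K s.
Proof.
by elim: n => //= n; apply: le_trans; apply: quad_pivot_le; exact: psd_pivotn.
Qed.

Lemma pivotn_lt n m y : (m < n)%N -> pivotn n (d m) y = 0.
Proof.
elim: n y => //= n IH y; rewrite ltnS leq_eqVlt => /predU1P[->|mn].
  by apply: pivot_self; exact: psd_pivotn.
by apply: pivot0 => z; exact: IH.
Qed.

(** The [n]-th column of the Cholesky factor; for a zero pivot, division by zero makes the whole
    column zero. *)
Definition chol x n : R := pivotn n x (d n) / Num.sqrt (pivotn n (d n) (d n)).

(** Telescoping: the pivot at [d n] subtracts exactly [chol x n * chol y n]. *)
Lemma psum_chol x y n : psum (chol x) (chol y) n = K x y - pivotn n x y.
Proof.
elim: n => [|n IH]; first by rewrite /psum big_ord0 subrr.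
have -> : psum (chol x) (chol y) n.+1 = psum (chol x) (chol y) n + chol x n * chol y n.
  by rewrite /psum big_ord_recr.
rewrite IH /= /pivot -addrA; congr (_ + _); rewrite opprB addrC; congr (_ - _).
rewrite /chol mulf_div -expr2 sqr_sqrtr ?psd_diag_ge0//; last exact: psd_pivotn.
by have [Ps _] := psd_pivotn n; rewrite (Ps y).
Qed.

Lemma chol_sqsum x : (chol x : nat -> R) \in sqsum.
Proof.
apply/asboolP; exists (K x x) => n.
have := psum_chol x x n; rewrite /psum; under eq_bigr do rewrite -expr2.
by move=> ->; rewrite gerBl psd_diag_ge0//; exact: psd_pivotn.
Qed.

Hypothesis d_dense : forall x e, 0 < e ->
  exists m, K x x - 2 * K x (d m) + K (d m) (d m) <= e.

(** The residual form at the difference of the point masses at [x] and [d m] is at most that of [K],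
    hence small for a suitable [m]. Once [d m] has been eliminated, its row vanishes and only the
    residual diagonal entry at [x] remains. *)
Lemma pivotn_diag_cvg0 x : pivotn n x x @[n --> \oo] --> (0 : R).
Proof.
apply/cvgrPdist_le => e e0; have [m hm] := d_dense x e0.
near=> n; rewrite sub0r normrN ger0_norm ?psd_diag_ge0//; last exact: psd_pivotn.
have mn : (m < n)%N by near: n; exact: nbhs_infty_gt.
apply: le_trans hm; have := quad_pivotn_le n [:: (1, x); (- 1, d m)].
have [Ks _] := Kpsd; have [Kns _] := psd_pivotn n.
by rewrite !quad_pair// (Kns x) !pivotn_lt//; lra.
Unshelve. all: end_near. Qed.

Lemma psd_realize : exists w : I -> l2 R, forall x y,
  `|w x - w y| ^+ 2 = K x x - 2 * K x y + K y y.
Proof.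
exists (fun x => L2 (chol_sqsum x)) => x y; rewrite l2normE l2norm_sqr.
apply: (cvg_lim (@Rhausdorff R)).
have -> : psum (L2 (chol_sqsum x) - L2 (chol_sqsum y))
    (L2 (chol_sqsum x) - L2 (chol_sqsum y)) = fun n =>
    (K x x - 2 * K x y + K y y) -
      (pivotn n x x - 2 * pivotn n x y + pivotn n y y).
  apply/funext => n.
  transitivity (psum (chol x) (chol x) n - 2 * psum (chol x) (chol y) n
      + psum (chol y) (chol y) n); last by rewrite !psum_chol; ring.
  rewrite /psum mulr_sumr -sumrB -big_split; apply: eq_bigr => k _ /=.
  by rewrite -[LHS]/((chol x k - chol y k) * (chol x k - chol y k)); ring.
rewrite -[X in _ --> X]subr0; apply: cvgB; first exact: cvg_cst.
(* The squared distances given by the residual kernel lie between [0] and twice the sum of two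
   diagonal entries, which tend to [0]. *)
apply: (squeeze_cvgr (f := fun=> 0) (h := fun n => 2 * pivotn n x x + 2 * pivotn n y y)).
- apply: nearW => n; have Pn := psd_pivotn n; rewrite psd_pair_le// andbT.
  have [Ps P0] := Pn; have := P0 [:: (1, x); (- 1, y)]; rewrite quad_pair//; lra.
- exact: cvg_cst.
- rewrite -[X in _ --> X]addr0 -[X in _ --> X + X](mulr0 2).
  by apply: cvgD; apply: cvgMr; exact: pivotn_diag_cvg0.
Qed.

End Realize.

(** Conditionally negative definite, normalized on the diagonal: the kernels that arise as squared
    distances of Hilbert-valued maps. *)
Definition cnd K := [/\ forall x y, K x y = K y x, forall x, K x x = 0
  & forall s, \sum_(a <- s) a.1 = 0 -> quad K s <= 0].

Lemma cnd_realize K (d : nat -> I) : cnd K ->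
  (forall x e, 0 < e -> exists m, K x (d m) <= e) ->
  exists w : I -> l2 R, forall x y, `|w x - w y| ^+ 2 = K x y.
Proof.
move=> [Ks Kd K0] d_dense; pose o := d 0.
(* The would-be inner product of [w x - w o] and [w y - w o]. *)
pose G x y := (K x o + K y o - K x y) / 2.
have GK x y : G x x - 2 * G x y + G y y = K x y by rewrite /G !Kd; field.
have Gpsd : psd G.
  split=> [x y|s]; first by rewrite /G (Ks x y) (addrC (K x o)).
  (* The base point takes the weight that makes the total zero, so that conditional negativity
     applies to the enlarged list. *)
  pose t := - \sum_(a <- s) a.1.
  have : quad K ((t, o) :: s) <= 0 by apply: K0; rewrite big_cons/= addNr.
  rewrite quad_cons// Kd mulr0 add0r.
  suff -> : quad G s = - (2 * t * lin K s o + quad K s) / 2 by lra.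
  have -> : 2 * t * lin K s o = - quad (fun x y => K x o + K y o) s.
    by rewrite (quad_sum (K^~ o)) /t /lin; ring.
  have -> : quad G s = quad (fun x y => 2^-1 * ((K x o + K y o) + (- 1) * K x y)) s.
    by apply: eq_bigr => a _; apply: eq_bigr => b _; rewrite /G; congr (_ * _); field.
  by rewrite quadZ quadD quadZ; field.
have [|w hw] := @psd_realize G d Gpsd; last by exists w => x y; rewrite hw GK.
by move=> x e /(d_dense x)[m hm]; exists m; rewrite GK.
Qed.

End Kernels.

(** * Schoenberg's snowflake *)

Section Snowflake.
Context {R : realType}.

(** Iteration towards the fixed point [1 - sqrt (1 - y)] of [q = (y + q^2) / 2]. Each iterate is a
    polynomial in [y] with nonnegative coefficients, so by the Schur product theorem it preserves
    positive semidefinite kernels. *)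
Fixpoint sqrt_iter (n : nat) (y : R) : R :=
  if n is m.+1 then (y + sqrt_iter m y ^+ 2) / 2 else 0.

Lemma cvg_sqrt_iter (y : R) : 0 <= y <= 1 ->
  sqrt_iter n y @[n --> \oo] --> 1 - Num.sqrt (1 - y).
Proof.
move=> /andP[y0 y1]; pose q n := sqrt_iter n y.
have q01 n : 0 <= q n <= 1.
  by rewrite /q; elim: n => [|n /andP[q0 q1]] /=; [rewrite lexx ler01|apply/andP; split; nra].
have q_nd : nondecreasing_seq q.
  apply/nondecreasing_seqP; rewrite /q; elim => [|n IH] /=; first by lra.
  by move: (q01 n) (q01 n.+1) IH; rewrite /q /= => /andP[? ?] /andP[? ?] ?; nra.
have q_cvg : cvgn q.
  by apply: nondecreasing_is_cvgn => //; exists 1 => _ [n _ <-]; have /andP[] := q01 n.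
(* Of the two roots of the limit equation, this bound selects [1 - sqrt (1 - y)]. *)
have q1 : limn q <= 1 by apply: limr_le => //; apply: nearW => n; have /andP[] := q01 n.
have fix_q : (1 - limn q) ^+ 2 = 1 - y.
  have qS : q n.+1 @[n --> \oo] --> limn q by rewrite (cvg_shiftS q).
  have : q n.+1 @[n --> \oo] --> (y + limn q * limn q) / 2.
    apply: cvgM; last exact: cvg_cst.
    by apply: cvgD; [exact: cvg_cst|apply: cvgM].
  by move/(cvg_unique (@Rhausdorff R) qS) => E; nra.
have -> : 1 - Num.sqrt (1 - y) = limn q; last exact: q_cvg.
by rewrite -fix_q sqrtr_sqr ger0_norm ?subr_ge0//; ring.
Qed.

Context {I : eqType}.

Lemma psd_sqrt (K : I -> I -> R) : psd K -> (forall x y, 0 <= K x y <= 1) ->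
  psd (fun x y => 1 - Num.sqrt (1 - K x y)).
Proof.
move=> Kpsd K01; apply: (@psd_lim _ _ (fun n x y => sqrt_iter n (K x y))); last first.
  by move=> x y; exact: cvg_sqrt_iter.
elim => [|n IH] /=.
  by split=> // s; rewrite /quad big1// => a _; rewrite big1// => b _; rewrite mulr0.
have := psdZ (_ : 0 <= 2^-1) (psdD Kpsd (psd_schur IH IH)).
rewrite invr_ge0 ler0n => /(_ isT).
by congr psd; apply/funext => x; apply/funext => y; rewrite mulrC -expr2.
Qed.

Context {H : completeNormedModType R} (dot : {dot H for idfun}).
Hypothesis dotE : forall x : H, dot x x = `|x| ^+ 2.

Lemma hdotC x y : dot x y = dot y x.
Proof. by rewrite hermC/= mul1r. Qed.

Lemma hdotZl a x y : dot (a *: x) y = a * dot x y.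
Proof. exact: linearZl_LR. Qed.

Lemma hdotZr a x y : dot x (a *: y) = a * dot x y.
Proof. exact: linearZr_LR. Qed.

Lemma hnorm_sub x y : `|x - y| ^+ 2 = dot x x + dot y y - 2 * dot x y.
Proof. by rewrite -dotE linearBl/= !linearBr/= (hdotC y x); ring. Qed.

Lemma psd_gram (u : I -> H) : psd (fun x y => dot (u x) (u y)).
Proof.
split=> [x y|s]; first exact: hdotC.
suff -> : quad (fun x y => dot (u x) (u y)) s =
    dot (\sum_(a <- s) a.1 *: u a.2) (\sum_(a <- s) a.1 *: u a.2).
  by rewrite dotE sqr_ge0.
rewrite linear_sumlz/=; apply: eq_bigr => a _; rewrite linear_sumr/=; apply: eq_bigr => b _.
by rewrite hdotZl hdotZr mulrA.
Qed.

(* With [A = |u|^2] and [t = sqrt (1 + A)], the kernel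
   [1 - |u x - u y|^2 / (t x t y)^2 = (1 + A x A y + 2 <u x, u y>) / (t x t y)^2]
   is positive semidefinite with values in [0, 1]. *)
Lemma quad_norm_le (u : I -> H) (s : seq (R * I)) :
  quad (fun x y => `|u x - u y|) s <=
  (\sum_(a <- s) a.1 * Num.sqrt (1 + `|u a.2| ^+ 2)) ^+ 2.
Proof.
pose A x := `|u x| ^+ 2; pose t x := Num.sqrt (1 + A x).
have A0 x : 0 <= A x by rewrite sqr_ge0.
have t2 x : t x ^+ 2 = 1 + A x by rewrite sqr_sqrtr// addr_ge0.
have t0 x : 0 < t x by rewrite sqrtr_gt0 ltr_pwDl.
pose K x y := (t x ^+ 2)^-1 * (t y ^+ 2)^-1 * (1 * 1 + (A x * A y + 2 * dot (u x) (u y))).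
have Kpsd : psd K.
  apply: (@psd_mulw _ _ _ (fun x => (t x ^+ 2)^-1)).
  apply: psdD; first exact: (@psd_rank1 _ _ (fun=> 1)).
  by apply: psdD; [exact: psd_rank1|apply: psdZ => //; exact: psd_gram].
have KE x y : 1 - K x y = (`|u x - u y| / (t x * t y)) ^+ 2.
  rewrite /K !t2 !(expr_div_n, exprMn) hnorm_sub !t2 !dotE -/(A x) -/(A y).
  by field; rewrite !gt_eqF// ltr_pwDl.
have K01 x y : 0 <= K x y <= 1.
  apply/andP; split; last by rewrite -subr_ge0 KE sqr_ge0.
  rewrite mulr_ge0 ?mulr_ge0 ?invr_ge0 ?sqr_ge0//.
  (* This gives [<u x, u y> >= - |u x| |u y|], so the numerator of [K] is at least
     [(|u x| |u y| - 1)^2]. *)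
  have : (`|u x| - `|u y|) ^+ 2 <= `|u x + u y| ^+ 2.
    rewrite -[leLHS]real_normK ?num_real// ler_pXn2r// ?nnegrE//.
    by have := ler_dist_dist (u x) (- u y); rewrite opprK normrN.
  have -> : `|u x + u y| ^+ 2 = A x + A y + 2 * dot (u x) (u y).
    by rewrite -dotE linearDl/= !linearDr/= (hdotC (u y)) !dotE /A; ring.
  have := sqr_ge0 (`|u x| * `|u y| - 1); rewrite /A; nra.
have := psd_mulw t (psd_sqrt Kpsd K01) => -[_ /(_ s)].
(* The distance is the rank-one kernel [t x * t y] minus a positive semidefinite kernel. *)
suff -> : quad (fun x y => `|u x - u y|) s = quad (fun x y => t x * t y + (- 1) *
    (t x * t y * (1 - Num.sqrt (1 - K x y)))) s.
  by rewrite quadD quad_rank1 quadZ mulN1r gerBl.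
apply: eq_bigr => a _; apply: eq_bigr => b _; congr (_ * _).
rewrite KE sqrtr_sqr ger0_norm ?divr_ge0 ?mulr_ge0 ?(ltW (t0 _))//.
by field; rewrite !gt_eqF.
Qed.

(** Scaling [u] by [d] multiplies the form by [d]. In the bound of [quad_norm_le] the zero total
    weight lets each square root be decreased by [1], which leaves a term of order [d^4]; a small
    [d] then excludes a positive value. *)
Lemma cnd_snowflake (u : I -> H) : cnd (fun x y => `|u x - u y|).
Proof.
split=> [x y|x|s s0]; [exact: distrC|by rewrite subrr normr0|].
rewrite leNgt; apply/negP; set S := quad _ _ => S0.
pose B := \sum_(a <- s) `|a.1| * `|u a.2| ^+ 2.
have scaled (d : R) : 0 < d -> d * S <= (d ^+ 2 * B) ^+ 2.
  move=> d0; have := quad_norm_le (fun x => d *: u x) s.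
  have -> : quad (fun x y => `|d *: u x - d *: u y|) s = d * S.
    rewrite -quadZ; apply: eq_bigr => a _; apply: eq_bigr => b _.
    by rewrite -scalerBr normrZ gtr0_norm.
  move=> /le_trans; apply; rewrite -[leLHS]real_normK ?num_real//.
  rewrite ler_pXn2r// ?nnegrE ?normr_ge0//; last first.
    by rewrite mulr_ge0 ?sqr_ge0 ?sumr_ge0// => a _; rewrite mulr_ge0 ?sqr_ge0.
  have -> : \sum_(a <- s) a.1 * Num.sqrt (1 + `|d *: u a.2| ^+ 2) =
      \sum_(a <- s) a.1 * (Num.sqrt (1 + `|d *: u a.2| ^+ 2) - 1).
    by under [RHS]eq_bigr do rewrite mulrBr mulr1; rewrite sumrB s0 subr0.
  rewrite mulr_sumr.
  apply: (le_trans (ler_norm_sum _ _ _)); apply: ler_sum => a _.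
  rewrite normrM mulrCA ler_wpM2l// normrZ exprMn (gtr0_norm d0).
  set z := d ^+ 2 * _; have z0 : 0 <= z by rewrite mulr_ge0 ?sqr_ge0.
  have : 1 <= Num.sqrt (1 + z) by rewrite -{1}sqrtr1 ler_sqrt ?lerDl ?addr_ge0.
  have : Num.sqrt (1 + z) ^+ 2 = 1 + z by rewrite sqr_sqrtr// addr_ge0.
  by set r := Num.sqrt _ => rz r1; rewrite ger0_norm ?subr_ge0//; nra.
(* With this [d <= 1] one gets [S <= d^3 B^2 <= d B^2], while [d (S + B^2 + 1) = S] makes [d B^2]
   smaller than [S]. *)
have B0 := sqr_ge0 B; pose d := S / (S + B ^+ 2 + 1).
have E0 : 0 < S + B ^+ 2 + 1 by rewrite ltr_wpDl// ltW// ltr_wpDr.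
have d0 : 0 < d by rewrite divr_gt0.
have dE : d * (S + B ^+ 2 + 1) = S by rewrite /d mulfVK ?gt_eqF.
have d1 : d <= 1 by rewrite ler_pdivrMr// mul1r; lra.
have : S <= d ^+ 3 * B ^+ 2.
  by rewrite -(ler_pM2l d0) (le_trans (scaled d d0))// le_eqVlt; apply/orP; left; apply/eqP; ring.
have : d ^+ 3 * B ^+ 2 <= d * B ^+ 2.
  by rewrite ler_wpM2r// exprSr ler_piMl ?exprn_ile1 ?(ltW d0).
by nra.
Qed.

End Snowflake.

(** * Minty's extension theorem *)

Lemma cvg_vsum_seq (R : realType) (V : normedModType R) (T I : Type)
    (F : set_system T) {FF : Filter F} (r : seq I) (f : I -> T -> V) (a : I -> V) :
  (forall i, f i x @[x --> F] --> a i) ->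
  \sum_(i <- r) f i x @[x --> F] --> \sum_(i <- r) a i.
Proof. by move=> fa; apply: cvg_big => //; exact: add_continuous. Qed.

Section Minty.
Context {R : realType} {H : completeNormedModType R} (dot : {dot H for idfun}).
Hypothesis dotE : forall x : H, dot x x = `|x| ^+ 2.

Let hdotDl x y z : dot (x + y) z = dot x z + dot y z. Proof. exact: linearDl. Qed.
Let hdotDr x y z : dot z (x + y) = dot z x + dot z y. Proof. exact: linearDr. Qed.

Definition simplex n : set 'rV[R]_n :=
  [set v | (forall i, 0 <= v 0 i) /\ \sum_i v 0 i = 1].

Lemma simplex_compact n : compact (@simplex n).
Proof.
have -> : @simplex n = [set v | forall i, `[0, 1]%classic (v ord0 i)] `&`
    [set v | \sum_i v 0 i = 1].
  apply/seteqP; split=> v /= [v0 v1]; split=> // i.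
    rewrite in_itv/= v0/= -v1 (bigD1 i)//= lerDl sumr_ge0// => j _; exact: v0.
  by have := v0 i; rewrite in_itv/= => /andP[].
apply: compact_closedI.
  apply: (@rV_compact R n (fun=> `[0, 1]%classic)) => i; exact: segment_compact.
have sum_cont : continuous (fun v : 'rV[R]_n => \sum_i v 0 i).
  by move=> v; apply: (cvg_sum_seq (FF := nbhs_filter v)) => i _; exact: (@coord_continuous R 1 _ 0 i v).
by apply: (preimage_closed (f := fun v : 'rV[R]_n => \sum_i v 0 i)
  (fun v _ => sum_cont v) (@closed_eq R 1)).
Qed.

(* The function [sum_i l i (|y i|^2 - r i) - |sum_i l i y i|^2] is nonpositive on the
   simplex; at a maximum [l] the derivative towards the vertex [k] says that
   [p = sum_i l i y i] satisfies [|p - y k|^2 - r k <= max]. *)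
Lemma minty_point n (y : 'I_n.+1 -> H) (r : 'I_n.+1 -> R) :
  (forall i j, `|y i - y j| ^+ 2 <= r i + r j) ->
  exists p, forall i, `|p - y i| ^+ 2 <= r i.
Proof.
move=> yr; pose b i := `|y i| ^+ 2 - r i.
pose comb (v : 'rV[R]_n.+1) := \sum_i v 0 i *: y i.
pose Phi (v : 'rV[R]_n.+1) := \sum_i v 0 i * b i - `|comb v| ^+ 2.
have Phi_cvg (F : set_system 'rV[R]_n.+1) (FF : Filter F) (v : 'rV[R]_n.+1) :
    (forall i, (x : 'rV[R]_n.+1) 0 i @[x --> F] --> v 0 i) ->
    Phi x @[x --> F] --> Phi v.
  move=> coord_cvg; apply: cvgB.
    by apply: cvg_sum_seq => i _; apply: cvgMr_tmp; exact: coord_cvg.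
  have comb_cvg : comb x @[x --> F] --> comb v.
    by apply: cvg_vsum_seq => i; apply: cvgZr_tmp; exact: coord_cvg.
  by apply: cvgM; exact: cvg_norm.
have Phi_cont : continuous Phi.
  by move=> v; apply: (Phi_cvg _ (nbhs_filter v)) => i; exact: (@coord_continuous R 1 _ 0 i v).
pose e k : 'rV[R]_n.+1 := delta_mx 0 k.
have ek k : simplex (e k).
  split=> [i|]; first by rewrite mxE eqxx ler0n.
  by rewrite (bigD1 k)//= mxE !eqxx big1 ?addr0// => j /negPf jk; rewrite mxE eqxx jk.
have [l] := compact_EVT_max (ex_intro _ _ (ek 0)) (@simplex_compact n.+1)
  (continuous_subspaceT Phi_cont).
rewrite inE => -[l0 l1] lmax; pose p := comb l; exists p => k.
have Phi_le0 : Phi l <= 0.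
  (* Averaging the hypothesis with weights [l i * l j] gives a nonnegative sum, equal to
     [- 2 Phi l]. *)
  have : 0 <= \sum_i \sum_j l 0 i * l 0 j * (r i + r j - `|y i - y j| ^+ 2).
    by rewrite sumr_ge0// => i _; rewrite sumr_ge0// => j _; rewrite !mulr_ge0// subr_ge0.
  suff -> : \sum_i \sum_j l 0 i * l 0 j * (r i + r j - `|y i - y j| ^+ 2) = - 2 * Phi l.
    by lra.
  have -> : Phi l = \sum_i l 0 i * b i - dot p p by rewrite dotE.
  have -> : dot p p = \sum_i \sum_j l 0 i * l 0 j * dot (y i) (y j).
    rewrite linear_sumlz/=; apply: eq_bigr => i _; rewrite linear_sumr/=.
    by apply: eq_bigr => j _; rewrite (hdotZl dot) (hdotZr dot) mulrA.
  have sum1 (F : 'I_n.+1 -> R) : \sum_i l 0 i * F i = \sum_i \sum_j l 0 i * l 0 j * F i.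
    by apply: eq_bigr => i _; rewrite -mulr_suml -mulr_sumr l1 mulr1.
  have sum2 (F : 'I_n.+1 -> R) : \sum_i l 0 i * F i = \sum_i \sum_j l 0 i * l 0 j * F j.
    rewrite sum1 exchange_big; apply: eq_bigr => i _; apply: eq_bigr => j _.
    by rewrite (mulrC (l 0 i)).
  transitivity (- \sum_i l 0 i * b i - \sum_i l 0 i * b i +
      2 * \sum_i \sum_j l 0 i * l 0 j * dot (y i) (y j)); last by ring.
  rewrite {1}sum1 sum2 -!sumrN mulr_sumr -!big_split; apply: eq_bigr => i _ /=.
  rewrite -!sumrN mulr_sumr -!big_split; apply: eq_bigr => j _ /=.
  by rewrite (hnorm_sub dotE) /b !dotE; ring.
suff : `|p - y k| ^+ 2 - r k <= Phi l by lra.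
(* Maximality is tested at [(1 - t) l + t e k]; after division by [t], the second-order term
   [t |p - y k|^2] is the only error. *)
have step t : 0 < t <= 1 -> `|p - y k| ^+ 2 - r k - Phi l <= t * `|p - y k| ^+ 2.
  move=> /andP[t0 t1]; pose v := (1 - t) *: l + t *: e k.
  have sv : simplex v.
    have [ek0 ek1] := ek k; split=> [i|].
      by rewrite !mxE addr_ge0// mulr_ge0// ?subr_ge0// ltW.
    under eq_bigr do rewrite !mxE; rewrite big_split/= -!mulr_sumr l1.
    have -> : \sum_i ((0 == 0 :> 'I_1) && (i == k))%:R = 1 :> R.
      by rewrite -[RHS]ek1; apply: eq_bigr => i _; rewrite mxE.
    by ring.
  have /lmax := mem_set sv.
  have sumv (F : 'I_n.+1 -> R) :
      \sum_i v 0 i * F i = (1 - t) * (\sum_i l 0 i * F i) + t * F k.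
    under eq_bigr do rewrite !mxE mulrDl.
    rewrite big_split/= mulr_sumr; congr (_ + _).
      by apply: eq_bigr => i _; rewrite mulrA.
    rewrite (bigD1 k)//= eqxx mulr1 big1 ?addr0// => i /negPf ->.
    by rewrite mulr0 mul0r.
  have combv : comb v = (1 - t) *: p + t *: y k.
    rewrite /comb; under eq_bigr do rewrite !mxE scalerDl.
    rewrite big_split/= scaler_sumr; congr (_ + _).
      by apply: eq_bigr => i _; rewrite scalerA.
    rewrite (bigD1 k)//= eqxx mulr1 big1 ?addr0// => i /negPf ->.
    by rewrite mulr0 scale0r.
  rewrite {1}/Phi sumv combv -(dotE (_ + _)) !(hdotDl, hdotDr, hdotZl dot, hdotZr dot).
  rewrite (hdotC dot (y k)) (hnorm_sub dotE) /Phi -/p /b -!dotE.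
  set s := \sum_i _; set pp := dot p p; set py := dot p (y k); set yy := dot _ _.
  move=> h; rewrite -(ler_pM2l t0); nra.
rewrite -subr_le0; apply/ler_addgt0Pl => eps eps0; rewrite addr0.
pose t := Num.min 1 (eps / (`|p - y k| ^+ 2 + 1)).
have q0 : 0 < `|p - y k| ^+ 2 + 1 by rewrite ltr_wpDl// sqr_ge0.
have t0 : 0 < t by rewrite lt_min ltr01 divr_gt0.
apply: (le_trans (step t _)); first by rewrite t0 ge_min lexx.
apply: (@le_trans _ _ (t * (`|p - y k| ^+ 2 + 1))); first by rewrite ler_pM2l// lerDl.
by rewrite -ler_pdivlMr// ge_min lexx orbT.
Qed.

End Minty.

(** * Nets, extension and embedding for finite sets *)

Section FiniteSets.
Context {R : realType} {X : normedModType R}.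

(** The segment from [y] to [x] is cut into [n] equal steps of length at most [1], and [f] moves by
    at most [tau] on each. *)
Lemma dist_subdivide {Y : normedModType R} (f : X -> Y) (tau : R) :
  (forall x y, `|x - y| <= 1 -> `|f x - f y| <= tau) ->
  forall (x y : X) n, `|x - y| <= n%:R -> `|f x - f y| <= n%:R * tau.
Proof.
move=> f1 x y [|n] xyn.
  have /eqP : `|x - y| = 0 by apply/eqP; rewrite eq_le xyn normr_ge0.
  by rewrite normr_eq0 subr_eq0 => /eqP ->; rewrite subrr normr0 mul0r.
pose z k := y + (k%:R / n.+1%:R) *: (x - y).
have zS k : `|z k.+1 - z k| <= 1.
  rewrite /z opprD addrACA subrr add0r -scalerBl -mulrBl -natrB// subSnn mul1r.
  by rewrite normrZ ger0_norm ?invr_ge0// mulrC ler_pdivrMr// mul1r.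
have hz k : `|f (z k) - f y| <= k%:R * tau.
  elim: k => [|k IH]; first by rewrite /z mul0r scale0r addr0 subrr normr0 mul0r.
  rewrite -(subrKA (f (z k))) (le_trans (ler_normD _ _))//.
  by rewrite -natr1 mulrDl mul1r addrC lerD// f1.
have zn : z n.+1 = x by rewrite /z divff ?pnatr_eq0// scale1r [LHS]addrC subrK.
by have := hz n.+1; rewrite zn.
Qed.

(** The number of unit steps is at most [|x - y| + 1], hence at most [2 |x - y|] at distances at
    least [1]. *)
Lemma threshold_lipschitz {Y : normedModType R} (f : X -> Y) (tau : R) : 0 <= tau ->
  (forall x y, `|x - y| <= 1 -> `|f x - f y| <= tau) ->
  forall x y, 1 <= `|x - y| -> `|f x - f y| <= 2 * tau * `|x - y|.
Proof.
move=> tau0 f1 x y xy1; have := truncn_itv (le_trans ler01 xy1).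
set n := Num.truncn _ => /andP[nxy xyn].
apply: le_trans (dist_subdivide f1 (ltW xyn)) _.
by rewrite [leRHS]mulrAC ler_wpM2r// -natr1; lra.
Qed.

(** Greedy choice: a new point joins [T] unless some point of [T] is already within distance [1]. *)
Lemma separated_net (s : seq X) : exists T : seq X, [/\ {subset T <= s},
  {in T &, forall x y, x != y -> 1 <= `|x - y|} &
  forall x, x \in s -> exists2 t, t \in T & `|x - t| <= 1].
Proof.
elim: s => [|x s [T [Ts Tsep Tnet]]]; first by exists [::]; split.
have [[t tT xt]|xT] := pselect (exists2 t, t \in T & `|x - t| <= 1).
  exists T; split=> // [y /Ts|y]; first by rewrite inE => ->; rewrite orbT.
  by rewrite inE => /predU1P[->|/Tnet]; first by exists t.
have xfar t : t \in T -> 1 <= `|x - t|.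
  by move=> tT; rewrite leNgt; apply/negP => /ltW xt; apply: xT; exists t.
exists (x :: T); split=> [y|y z|y]; rewrite ?inE.
- by move=> /predU1P[->|/Ts ->]; rewrite ?eqxx ?orbT.
- move=> /predU1P[->|yT] /predU1P[->|zT]; rewrite ?eqxx// => yz.
  + exact: xfar.
  + by rewrite distrC xfar.
  + exact: Tsep.
- move=> /predU1P[->|/Tnet[t tT yt]]; last by exists t; rewrite // inE tT orbT.
  by exists x; rewrite ?mem_head// subrr normr0.
Qed.

Context {H : completeNormedModType R} (dot : {dot H for idfun}).
Hypothesis dotE : forall x : H, dot x x = `|x| ^+ 2.

(** Points are added one at a time. With radii [r y = C |x - y|], the triangle inequality turns
    [|g y - g z|^2 <= C |y - z|] into the hypothesis of [minty_point]. *)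
Lemma minty_extension (C : R) (T s : seq X) (g : X -> H) : 0 <= C ->
  {in T &, forall x y, `|g x - g y| ^+ 2 <= C * `|x - y|} ->
  exists2 g' : X -> H, {in T, g' =1 g} &
    {in s ++ T &, forall x y, `|g' x - g' y| ^+ 2 <= C * `|x - y|}.
Proof.
move=> C0 gT; elim: s => [|x s [g' g'T g's]]; first by exists g.
case L : (s ++ T) => [|t L'].
  exists g' => // y z; rewrite /= L !inE => /eqP-> /eqP->.
  by rewrite !subrr !normr0 expr0n mulr0.
have [xL|xL] := boolP (x \in s ++ T).
  have subL : {subset (x :: s) ++ T <= s ++ T}.
    by move=> y; rewrite /= inE => /predU1P[->|].
  by exists g' => // y z /subL yL /subL; exact: g's.
have nthL (i : 'I_(size L').+1) : nth t (s ++ T) i \in s ++ T by rewrite mem_nth// L.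
have [i j|p hp] := @minty_point _ _ dot dotE _ (fun i : 'I_(size L').+1 => g' (nth t (s ++ T) i))
    (fun i => C * `|x - nth t (s ++ T) i|).
  apply: le_trans (g's _ _ (nthL i) (nthL j)) _; rewrite -mulrDr ler_wpM2l//.
  by rewrite -(subrKA x) (le_trans (ler_normD _ _))// distrC.
have hpL y : y \in s ++ T -> `|p - g' y| ^+ 2 <= C * `|x - y|.
  move=> yL; have iy : (index y (s ++ T) < (size L').+1)%N.
    by rewrite -[X in (_ < X)%N]/(size (t :: L')) -L index_mem.
  by have := hp (Ordinal iy); rewrite /= nth_index.
exists (fun y => if y == x then p else g' y) => [y yT|y z].
  by case: eqP => [yx|_]; [move: xL; rewrite -yx mem_cat yT orbT|exact: g'T].
rewrite /= !inE; case: eqP => [->|_] /=; case: eqP => [->|_] //=.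
- by rewrite !subrr !normr0 expr0n mulr0.
- by move=> _; exact: hpL.
- by move=> yL _; rewrite distrC (distrC y) hpL.
- exact: g's.
Qed.

End FiniteSets.

Lemma finite_embedding (R : realType) (X : normedModType R)
    (H : completeNormedModType R) (f : X -> H) (D tau1 tau2 : R) (s : seq X) :
  is_hilbert H -> 0 <= tau1 ->
  threshold_map (@norm_dist R X) (@norm_dist R H) 1 D tau1 tau2 f ->
  exists g : X -> l2 R,
    {in s &, forall x y, `|g x - g y| ^+ 2 <= 2 * tau1 * `|x - y|} /\
    {in s &, forall x y, D + 2 <= `|x - y| ->
      Num.sqrt tau2 - Num.sqrt (8 * tau1) <= `|g x - g y|}.
Proof.
move=> [dot dotE] tau1_ge0 [f1 f2].
have detour (a b1 b2 b3 m r : R) :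
  a <= b1 + b2 + b3 -> b1 <= r -> b3 <= r -> m <= a -> m - 2 * r <= b2 by lra.
have [[|t T'] [Ts Tsep Tnet]] := separated_net s.
  have s0 x : x \notin s by apply/negP => /Tnet[].
  by exists (fun=> 0); split=> x y xs; move: (s0 x); rewrite xs.
set T := t :: T' in Ts Tsep Tnet.
(* Precomposing with [proj] makes the kernel on [X] factor through the finite set [T], so that an
   enumeration of [T] is dense for it. *)
pose proj x := if x \in T then x else t.
have projT x : proj x \in T by rewrite /proj; case: ifP => //; rewrite mem_head.
have proj_id x : x \in T -> proj x = x by rewrite /proj => ->.
have [w hw] : exists w : X -> l2 R, forall x y,
    `|w x - w y| ^+ 2 = `|f (proj x) - f (proj y)|.
  apply: (@cnd_realize _ _ _ (nth t T)).
    exact: (cnd_snowflake dotE (fun x => f (proj x))).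
  move=> x e e0; exists (index (proj x) T).
  by rewrite nth_index// (proj_id (proj x))// subrr normr0 ltW.
have wT : {in T &, forall x y, `|w x - w y| ^+ 2 <= 2 * tau1 * `|x - y|}.
  move=> x y xT yT; rewrite hw !proj_id//; have [->|xy] := eqVneq x y.
    by rewrite !subrr !normr0 mulr0.
  exact: (threshold_lipschitz tau1_ge0 f1 (Tsep _ _ xT yT xy)).
have [|g gw gs] := minty_extension (@l2dotE R) s _ wT; first by rewrite mulr_ge0.
have {}gs : {in s ++ T &, forall x y, `|g x - g y| ^+ 2 <= 2 * tau1 * `|x - y|} := gs.
exists g; split=> [x y xs ys|x y xs ys xy].
  by apply: gs; rewrite mem_cat ?xs ?ys.
have [[p pT xp] [q qT yq]] := (Tnet x xs, Tnet y ys).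
have near z r : z \in s -> r \in T -> `|z - r| <= 1 -> `|g z - g r| <= Num.sqrt (2 * tau1).
  move=> zs rT zr; rewrite -[leLHS]ger0_norm// -sqrtr_sqr ler_wsqrtr//.
  apply: le_trans (gs _ _ _ _) _; rewrite ?mem_cat ?zs ?rT ?orbT//.
  by rewrite ler_piMr// mulr_ge0.
have gpq : Num.sqrt tau2 <= `|g p - g q|.
  rewrite -[leRHS]ger0_norm// -sqrtr_sqr ler_wsqrtr// !gw// hw !proj_id//.
  (* [p] and [q] are within [1] of [x] and [y], so they are still at distance at least [D]. *)
  apply: f2; rewrite /norm_dist.
  have : `|x - y| <= `|x - p| + `|p - q| + `|y - q|.
    rewrite (distrC y) (_ : x - y = (x - p) + (p - q) + (q - y)).
      by rewrite (le_trans (ler_normD _ _))// lerD2r ler_normD.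
    by rewrite !subrKA.
  by lra.
(* The detours from [x] to [p] and from [q] to [y] cost at most [sqrt (2 tau1)] each, together
   [sqrt (8 tau1)]. *)
have -> : Num.sqrt (8 * tau1) = 2 * Num.sqrt (2 * tau1).
  rewrite (_ : 8 * tau1 = 2 ^+ 2 * (2 * tau1)); last by ring.
  by rewrite sqrtrM ?sqr_ge0// sqrtr_sqr ger0_norm.
apply: (detour _ _ _ _ _ _ _ (near x p xs pT xp) (near y q ys qT yq) gpq).
rewrite (distrC _ (g p)) (_ : g p - g q = (g p - g x) + (g x - g y) + (g y - g q)).
  by rewrite (le_trans (ler_normD _ _))// lerD2r ler_normD.
by rewrite !subrKA.
Qed.

(** * Ultralimits and invariant means *)

Section Ultralimits.
Context {R : realType}.

Lemma ultra_cvg (T : Type) (U : set_system T) (u : T -> R) (B : R) :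
  UltraFilter U -> (\forall t \near U, `|u t| <= B) -> cvg (u @ U).
Proof.
move=> UU uB; have uU : (u @ U) `[- B, B]%classic.
  by apply: filterS uB => t; rewrite /= in_itv/= ler_norml.
have [p [_ pcl]] := @segment_compact R (- B) B _ _ uU.
apply/cvg_ex; exists p => A Ap /=; rewrite nbhs_filterE.
have [//|UA] := in_ultra_setVsetC (u @^-1` A) UU.
by have [q [/= q1 q2]] := pcl (~` A) A UA Ap.
Qed.

(** Tails of the pairs of a finite set and an integer, directed by inclusion and by [<=]; a list
    stands for its set of elements. *)
Definition eventual (X : eqType) : set_system (seq X * nat) :=
  fun A => exists (s0 : seq X) n0, forall (s : seq X) n, {subset s0 <= s} -> (n0 <= n)%N -> A (s, n).

Lemma eventual_proper (X : eqType) : ProperFilter (@eventual X).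
Proof.
split=> [[s [n /(_ s n (fun _ => id) (leqnn n))]]//|]; split.
- by exists [::], 0%N.
- move=> A B [s1 [n1 hA]] [s2 [n2 hB]]; exists (s1 ++ s2), (maxn n1 n2).
  move=> s n ss; rewrite geq_max => /andP[n1n n2n]; split.
    by apply: hA => // x xs; apply: ss; rewrite mem_cat xs.
  by apply: hB => // x xs; apply: ss; rewrite mem_cat xs orbT.
- by move=> A B AB [s0 [n0 hA]]; exists s0, n0 => s n ss nn; apply: AB; exact: hA.
Qed.

Lemma eventual_mem (X : eqType) (U : set_system (seq X * nat)) (s0 : seq X) :
  @eventual X `<=` U -> \forall t \near U, {subset s0 <= t.1}.
Proof. by move=> EU; apply: EU; exists s0, 0%N. Qed.

(** * Closure properties of conditionally negative definite kernels *)

Section Cnd.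
Context {I : eqType}.
Implicit Types (K : I -> I -> R).

Lemma cndD K L : cnd K -> cnd L -> cnd (fun x y => K x y + L x y).
Proof.
move=> [Ks Kd K0] [Ls Ld L0]; split=> [x y|x|s s0]; first by rewrite Ks Ls.
  by rewrite Kd Ld addr0.
by have := K0 s s0; have := L0 s s0; rewrite quadD; lra.
Qed.

Lemma cndZ K (c : R) : 0 <= c -> cnd K -> cnd (fun x y => c * K x y).
Proof.
move=> c0 [Ks Kd K0]; split=> [x y|x|s s0]; first by rewrite Ks.
  by rewrite Kd mulr0.
by rewrite quadZ mulr_ge0_le0 ?K0.
Qed.

Lemma cnd_sum (n : nat) (K : 'I_n -> I -> I -> R) :
  (forall i, cnd (K i)) -> cnd (fun x y => \sum_i K i x y).
Proof.
move=> Kc; elim: n K Kc => [|n IH] K Kc.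
  split=> [x y|x|s s0]; rewrite ?big_ord0//.
  by rewrite /quad big1// => a _; rewrite big1// => b _; rewrite big_ord0 mulr0.
rewrite (_ : (fun x y => _) = fun x y =>
    K ord0 x y + \sum_i K (lift ord0 i) x y); last first.
  by apply/funext => x; apply/funext => y; rewrite big_ord_recl.
by apply: cndD => //; apply: IH.
Qed.

Lemma cnd_lim (T : Type) (F : set_system T) (FF : ProperFilter F)
    (Kt : T -> I -> I -> R) K : (forall t, cnd (Kt t)) ->
  (forall x y, Kt t x y @[t --> F] --> K x y) -> cnd K.
Proof.
move=> Kc KtK; split=> [x y|x|s s0].
- apply: (cvg_unique (@Rhausdorff R) (KtK x y)).
  rewrite (_ : (fun t => Kt t x y) = fun t => Kt t y x); first exact: KtK.
  by apply/funext => t; have [->] := Kc t.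
- apply: (cvg_unique (@Rhausdorff R) (KtK x x)).
  rewrite (_ : (fun t => Kt t x x) = fun=> 0); first exact: cvg_cst.
  by apply/funext => t; have [_ ->] := Kc t.
- have Kts := @cvg_quad R I T F _ Kt K s KtK.
  by apply: (cvgr_to_le (Kts _)); apply: nearW => t; have [_ _ ->] := Kc t.
Qed.

Lemma cnd_sqdist {H : completeNormedModType R} (dot : {dot H for idfun}) (u : I -> H) :
  (forall x : H, dot x x = `|x| ^+ 2) -> cnd (fun x y => `|u x - u y| ^+ 2).
Proof.
move=> dotE; split=> [x y|x|s s0]; first by rewrite distrC.
  by rewrite subrr normr0 expr0n.
rewrite (_ : (fun x y => _) = fun x y => (dot (u x) (u x) + dot (u y) (u y)) +
    - 2 * dot (u x) (u y)); last first.
  by apply/funext => x; apply/funext => y; rewrite (hnorm_sub dotE); ring.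
rewrite quadD (quad_sum (fun x => dot (u x) (u x))) s0 mulr0 mul0r add0r quadZ.
by rewrite mulNr oppr_le0 mulr_ge0//; have [_] := psd_gram dotE u; apply.
Qed.

End Cnd.

(** * Averages over boxes *)

Section Means.
Context {X : lmodType R}.
Implicit Types (F G : X -> R) (v z : X).

Definition avg n v F z : R := n.+1%:R^-1 * \sum_(k < n.+1) F (z + v *+ k).

(** Iterating [avg] along the list averages over a whole box, the points [z + sum_v k_v v] with
    [0 <= k_v <= n]. *)
Definition mean (s : seq X) n F := foldr (avg n) F s.

Lemma avg_ge n v F (a : R) : (forall z, a <= F z) -> forall z, a <= avg n v F z.
Proof.
move=> aF z; rewrite /avg ler_pdivlMl ?ltr0Sn//.
rewrite mulr_natl -[X in a *+ X]card_ord -sumr_const.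
by apply: ler_sum => k _; exact: aF.
Qed.

Lemma avg_le n v F (a : R) : (forall z, F z <= a) -> forall z, avg n v F z <= a.
Proof.
move=> Fa z; rewrite /avg ler_pdivrMl ?ltr0Sn//.
rewrite mulr_natl -[X in a *+ X]card_ord -sumr_const.
by apply: ler_sum => k _; exact: Fa.
Qed.

Lemma mean_ge s n F (a : R) : (forall z, a <= F z) -> forall z, a <= mean s n F z.
Proof. by move=> aF; elim: s => //= v s IH; exact: avg_ge. Qed.

Lemma mean_le s n F (a : R) : (forall z, F z <= a) -> forall z, mean s n F z <= a.
Proof. by move=> Fa; elim: s => //= v s IH; exact: avg_le. Qed.

Lemma mean_shift s n F v z : mean s n (fun z => F (z + v)) z = mean s n F (z + v).
Proof.
elim: s z => //= w s IH z; rewrite /avg; congr (_ * _); apply: eq_bigr => k _.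
by rewrite IH addrAC.
Qed.

(** Along [v] the average and its shift differ in one term each, which costs [2 B / (n + 1)];
    averaging afterwards in other directions commutes with the shift and keeps the bound. *)
Lemma mean_invariant s n F v z (B : R) : v \in s -> (forall z, `|F z| <= B) ->
  `|mean s n F (z + v) - mean s n F z| <= n.+1%:R^-1 * (2 * B).
Proof.
move=> + FB; elim: s z => //= w s IH z; rewrite inE => /predU1P[->|vs].
  have GB y : `|mean s n F y| <= B.
    rewrite ler_norml mean_ge ?mean_le// => x; have := FB x; rewrite ler_norml => /andP[]//.
  rewrite /avg -mulrBr normrM ger0_norm ?invr_ge0// ler_wpM2l ?invr_ge0//.
  rewrite big_ord_recr/= big_ord_recl/= mulr0n addr0.
  have -> : \sum_(i < n) mean s n F (z + w + w *+ i) =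
      \sum_(i < n) mean s n F (z + w *+ bump 0 i).
    by apply: eq_bigr => i _; rewrite -addrA -mulrS.
  set S := \sum_(i < n) _; rewrite (_ : _ - _ =
    mean s n F (z + w + w *+ n) - mean s n F z); last by ring.
  by rewrite (le_trans (ler_normB _ _))// mulr2n mulrDl mul1r lerD.
have -> : avg n w (mean s n F) (z + v) - avg n w (mean s n F) z =
    avg n w (fun y => mean s n F (y + v) - mean s n F y) z.
  by rewrite /avg -mulrBr -sumrB; congr (_ * _); apply: eq_bigr => k _; rewrite addrAC.
rewrite ler_norml avg_ge ?avg_le// => y.
  by have := IH y vs; rewrite ler_norml => /andP[].
by have := IH y vs; rewrite ler_norml => /andP[].
Qed.

Lemma cnd_mean {I : eqType} s n (P : X -> I -> I -> R) :
  (forall z, cnd (P z)) -> forall z, cnd (fun x y => mean s n (fun z => P z x y) z).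
Proof.
move=> Pc; elim: s => //= v s IH z; apply: cndZ; first by rewrite invr_ge0.
exact: (cnd_sum (fun k : 'I_n.+1 => IH (z + v *+ k))).
Qed.

End Means.
End Ultralimits.

(** * From finite sets to a translation invariant kernel on the whole space *)

Section InvariantKernel.
Context {R : realType} {X : normedModType R}.
Variables (C D c : R).
Hypothesis c_ge0 : 0 <= c.

(** A pair of points lies in all sufficiently large finite sets, so the bounds for that pair hold on
    a member of the ultrafilter and pass to the ultralimit. *)
Lemma limit_kernel :
  (forall s : seq X, exists g : X -> l2 R,
    {in s &, forall x y, `|g x - g y| ^+ 2 <= C * `|x - y|} /\
    {in s &, forall x y, D <= `|x - y| -> c <= `|g x - g y|}) ->
  exists N : X -> X -> R, [/\ cnd N, forall x y, 0 <= N x y <= C * `|x - y|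
    & forall x y, D <= `|x - y| -> c ^+ 2 <= N x y].
Proof.
move=> /choice[g hg]; have [U [UU EU]] := ultraFilterLemma (eventual_proper X).
have UP : ProperFilter U by exact: ultra_proper.
pose K (t : seq X * nat) x y := `|g t.1 x - g t.1 y| ^+ 2.
have near_xy x y : \forall t \near U, x \in t.1 /\ y \in t.1.
  have := eventual_mem [:: x; y] EU; apply: (@filterS _ U) => t st.
  by split; apply: st; rewrite !inE eqxx ?orbT.
have K_cvg x y : cvg (K t x y @[t --> U]).
  apply: (@ultra_cvg R _ U _ (C * `|x - y|)) => //.
  have := near_xy x y; apply: (@filterS _ U) => t [xt yt].
  by rewrite ger0_norm ?sqr_ge0//; exact: (hg t.1).1.
exists (fun x y => lim (K t x y @[t --> U])); split.
- apply: (cnd_lim UP (Kt := K)) => [t|x y]; last exact: K_cvg.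
  exact: cnd_sqdist (@l2dotE R).
- move=> x y; apply/andP; split.
    by apply: limr_ge => //; apply: nearW => t; exact: sqr_ge0.
  apply: limr_le => //; have := near_xy x y; apply: (@filterS _ U) => t [xt yt].
  exact: (hg t.1).1.
- move=> x y xy; apply: limr_ge => //; have := near_xy x y; apply: (@filterS _ U) => t [xt yt].
  by rewrite ler_pXn2r ?nnegrE//; exact: (hg t.1).2.
Qed.

(** Translates of [N] satisfy the same bounds because the distance is translation invariant, and so
    do their averages. Every [v] is eventually among the directions of the box, so the defect of
    invariance under [v] is of order [1/n] and disappears in the ultralimit. *)
Lemma invariant_kernel (N : X -> X -> R) :
  cnd N -> (forall x y, 0 <= N x y <= C * `|x - y|) ->
  (forall x y, D <= `|x - y| -> c ^+ 2 <= N x y) ->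
  exists M : X -> X -> R, [/\ cnd M, forall x y, M x y <= C * `|x - y|,
    forall x y, D <= `|x - y| -> c ^+ 2 <= M x y
    & forall x y v, M (x + v) (y + v) = M x y].
Proof.
move=> Nc N0 ND; have [U [UU EU]] := ultraFilterLemma (eventual_proper X).
have UP : ProperFilter U by exact: ultra_proper.
pose F x y z := N (x + z) (y + z).
have dist_shift (x y z : X) : `|x + z - (y + z)| = `|x - y|.
  by rewrite opprD addrACA subrr addr0.
have F0 x y z : 0 <= F x y z by have /andP[] := N0 (x + z) (y + z).
have FC x y z : F x y z <= C * `|x - y|.
  by have /andP[_] := N0 (x + z) (y + z); rewrite dist_shift.
have F_norm x y z : `|F x y z| <= C * `|x - y| by rewrite ger0_norm.
pose K (t : seq X * nat) x y := mean t.1 t.2 (F x y) 0.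
have K_cvg x y : cvg (K t x y @[t --> U]).
  apply: (@ultra_cvg R _ U _ (C * `|x - y|)) => //; apply: nearW => t.
  by rewrite ger0_norm ?mean_ge ?mean_le.
exists (fun x y => lim (K t x y @[t --> U])); split.
- apply: (cnd_lim UP (Kt := K)) => [t|x y]; last exact: K_cvg.
  apply: cnd_mean => z; have [Ns Nd Nn] := Nc.
  split=> [x y|x|s s0]; [exact: Ns|exact: Nd|].
  have := Nn [seq (a.1, a.2 + z) | a <- s]; rewrite big_map => /(_ s0).
  by rewrite /quad big_map; under eq_bigr do rewrite big_map.
- by move=> x y; apply: limr_le => //; apply: nearW => t; exact: mean_le.
- move=> x y xy; apply: limr_ge => //; apply: nearW => t; apply: mean_ge => z.
  by apply: ND; rewrite dist_shift.
- move=> x y v; apply/eqP; rewrite -subr_eq0 -limB//; apply/eqP.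
  apply: cvg_lim => //; apply/cvgr0Pnorm_le => e e0.
  have [n0 hn0] : exists n0, n0.+1%:R^-1 * (2 * (C * `|x - y|)) <= e.
    exists (Num.truncn (2 * (C * `|x - y|) / e)).
    have := ltW (truncnS_gt (2 * (C * `|x - y|) / e)).
    by rewrite ler_pdivrMr// ler_pdivrMl.
  have : \forall t \near U, v \in t.1 /\ (n0 <= t.2)%N.
    apply: EU; exists [:: v], n0 => s n sv n0n; split=> //.
    by apply: sv; rewrite mem_head.
  apply: (@filterS _ U) => -[s n] [/= vs n0n]; rewrite /K /= !fctE.
  have -> : F (x + v) (y + v) = fun z => F x y (z + v).
    by apply/funext => z; rewrite /F -!addrA (addrC v).
  rewrite mean_shift (le_trans (mean_invariant n 0 vs (F_norm x y)))//.
  apply: le_trans hn0; apply: ler_wpM2r.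
    by rewrite pmulr_rge0// (le_trans (F0 x y 0)).
  by rewrite lef_pV2 ?posrE ?ltr0Sn// ler_nat ltnS.
Qed.

End InvariantKernel.

(** * Separability, the linear lower bound and the conclusion *)

Lemma finite_dimensional_separable (R : realType) (X : normedModType R) :
  finite_dimensional X ->
  exists d : nat -> X, forall x e, 0 < e -> exists m, `|x - d m| <= e.
Proof.
move=> [n [[v2r v2r_lin [r2v v2rK r2vK]]]].
have r2v_lin : linear r2v.
  by move=> a u w; apply: (can_inj v2rK); rewrite v2r_lin !r2vK.
pose r2vL : {linear 'rV[R]_n -> X} :=
  HB.pack r2v (GRing.isLinear.Build _ _ _ _ r2v r2v_lin).
(* Vectors with rational coordinates, enumerated by their codes; a number that codes nothing gives
   [0]. *)
pose d m := if unpickle m is Some q then r2v (map_mx ratr (q : 'rV[rat]_n)) else 0.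
exists d => x e e0; pose S := \sum_i `|r2v (delta_mx 0 i)|.
have S0 : 0 < S + 1 by rewrite ltr_wpDl// sumr_ge0.
(* An error of [eps] in every coordinate costs at most [eps * S] in norm; the added [1] covers
   [S = 0]. *)
pose eps := e / (S + 1); have eps0 : 0 < eps by rewrite divr_gt0.
have /choice[q hq] : forall i, exists q, `|v2r x 0 i - ratr q| <= eps.
  move=> i; have [q] := @rat_in_itvoo R (v2r x 0 i - eps) (v2r x 0 i + eps) ltac:(lra).
  by rewrite in_itv/= => /andP[q1 q2]; exists q; rewrite ler_norml; lra.
exists (pickle (\row_i q i)); rewrite /d pickleK -{1}(v2rK x).
have -> : forall u w, r2v u - r2v w = r2v (u - w) by move=> u w; rewrite -(raddfB r2vL).
rewrite [X in r2v X]row_sum_delta -[r2v]/(r2vL : _ -> _) linear_sum/=.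
apply: (le_trans (ler_norm_sum _ _ _)); apply: (@le_trans _ _ (\sum_i eps * `|r2v (delta_mx 0 i)|)).
  apply: ler_sum => i _; rewrite -[r2v (_ *: _)]/(r2vL _) linearZ/= normrZ.
  by apply: ler_wpM2r => //; rewrite !mxE.
by rewrite -mulr_sumr -/S mulrAC ler_pdivrMr// ler_pM2l// lerDl.
Qed.

Lemma translation_invariant_lower_bound (R : realType) (X H : normedModType R)
    (h : X -> H) (D c : R) :
  1 < D -> 0 <= c ->
  (forall x y v, `|h (x + v) - h (y + v)| = `|h x - h y|) ->
  (forall x y, D + 2 <= `|x - y| -> c <= `|h x - h y|) ->
  forall x y, c * Num.min 1 (`|x - y| / (2 * D + 4)) <= `|h x - h y|.
Proof.
move=> D1 c0 h_inv hD x y; have DD : 0 < 2 * D + 4 by lra.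
have [->|xy] := eqVneq x y.
  by rewrite !subrr !normr0 mul0r min_r ?mulr0.
have t0 : 0 < `|x - y| by rewrite normr_gt0 subr_eq0.
have [tD|tD] := leP (D + 2) `|x - y|.
  by apply: le_trans (hD _ _ tD); rewrite ler_piMr// ge_min lexx.
have h_mul n : `|h (y + (x - y) *+ n) - h y| <= n%:R * `|h x - h y|.
  elim: n => [|n IH]; first by rewrite mulr0n addr0 subrr normr0 mul0r.
  rewrite -(subrKA (h (y + (x - y) *+ n))) (le_trans (ler_normD _ _))//.
  rewrite -natr1 mulrDl mul1r addrC lerD// -(h_inv x y ((x - y) *+ n)).
  by rewrite mulrS addrA [y + (x - y)]addrC subrK.
(* Enough steps to reach distance [D + 2]. Rounding up overshoots by at most [|x - y| < D + 2],
   whence [n |x - y| <= 2 D + 4], the origin of that constant. *)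
pose n := (Num.truncn ((D + 2) / `|x - y|)).+1.
have Dt0 : 0 <= (D + 2) / `|x - y| by rewrite divr_ge0//; lra.
have n_ge : (D + 2) / `|x - y| <= n%:R by exact: ltW (truncnS_gt _).
have n_le : n%:R <= (D + 2) / `|x - y| + 1.
  by rewrite /n -natr1 lerD2r; have /andP[] := truncn_itv Dt0.
have cn : c <= n%:R * `|h x - h y|.
  apply: le_trans (h_mul n); apply: hD; rewrite addrAC subrr add0r normrMn.
  by rewrite -[_ *+ n]mulr_natl -ler_pdivrMr.
have n_le2 : n%:R * `|x - y| <= 2 * D + 4.
  have : n%:R * `|x - y| <= ((D + 2) / `|x - y| + 1) * `|x - y| by rewrite ler_pM2r.
  by rewrite mulrDl mulfVK ?gt_eqF// mul1r; lra.
apply: (@le_trans _ _ (c * (`|x - y| / (2 * D + 4)))).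
  by rewrite ler_wpM2l// ge_min lexx orbT.
rewrite mulrA ler_pdivrMr//.
apply: (@le_trans _ _ (n%:R * `|h x - h y| * `|x - y|)).
  by rewrite ler_wpM2r.
by rewrite mulrAC mulrC ler_wpM2l.
Qed.

Theorem theorem3p10 (R : realType) (D tau1 tau2 : R)
  (hD : 1 < D) (htau1 : 0 < tau1) (htau12 : tau1 < tau2)
  (htau2 : 8 * tau1 < tau2) :
  exists L U : R -> R,
  forall X : normedModType R,
    finite_dimensional X ->
    (exists H : completeNormedModType R, is_hilbert H /\
       exists f : X -> H,
         threshold_map (@norm_dist R X) (@norm_dist R H) 1 D tau1 tau2 f) ->
    exists H : completeNormedModType R, is_hilbert H /\
    exists h : X -> H,
      (forall x1 x2 : X,
         (Num.sqrt tau2 - Num.sqrt (8 * tau1))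
           * Num.min 1 (`|x1 - x2| / (2 * D + 4))
         <= `|h x1 - h x2|
         <= Num.sqrt (2 * tau1 * `|x1 - x2|)) /\
      uniform_embedding (@norm_dist R X) (@norm_dist R H) L U h.
Proof.
pose c := Num.sqrt tau2 - Num.sqrt (8 * tau1).
have c0 : 0 < c by rewrite subr_gt0 ltr_sqrt//; lra.
have DD : 0 < 2 * D + 4 by lra.
have tau0 : 0 <= 2 * tau1 by lra.
(* The two bounds themselves serve as moduli; chosen before [X], they depend only on [D], [tau1] and
   [tau2]. *)
exists (fun t => c * Num.min 1 (t / (2 * D + 4))), (fun t => Num.sqrt (2 * tau1 * t)).
move=> X Xfin [H [Hhilb [f fthr]]].
(* The kernel lemmas are used with [C = 2 tau1] and with [D + 2] as the distance threshold. *)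
have [N [Nc N0 ND]] := limit_kernel (ltW c0)
  (fun s => finite_embedding s Hhilb (ltW htau1) fthr).
have [M [Mc MC MD Minv]] := invariant_kernel Nc N0 ND.
have [d d_dense] := finite_dimensional_separable Xfin.
have [|h hM] := cnd_realize (d := d) Mc.
  (* Since [M x y <= 2 tau1 |x - y|], a sequence dense in norm is also dense for the kernel. *)
  move=> x e e0; have e'0 : 0 < e / (2 * tau1) by rewrite divr_gt0//; lra.
  have [m hm] := d_dense x _ e'0.
  by exists m; rewrite (le_trans (MC _ _))// mulrC -ler_pdivlMr//; lra.
have bounds x y : c * Num.min 1 (`|x - y| / (2 * D + 4)) <= `|h x - h y|
    <= Num.sqrt (2 * tau1 * `|x - y|).
  apply/andP; split; last first.
    by rewrite -[leLHS]ger0_norm// -sqrtr_sqr ler_wsqrtr// hM.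
  apply: translation_invariant_lower_bound => // [|{}x {}y v|{}x {}y xy].
  - exact: ltW.
  - by apply/eqP; rewrite -(@eqrXn2 _ 2)// !hM Minv.
  - by rewrite -(@ler_pXn2r _ 2)// ?nnegrE ?(ltW c0)// hM MD.
exists (l2 R); split; first exact: l2_hilbert.
exists h; split; first exact: bounds.
split=> //.
- split=> [t t0|s t s0 st].
    by rewrite mulr_ge0 ?(ltW c0)// le_min ler01 divr_ge0// ltW.
  rewrite ler_pM2l// le_min ge_min lexx/= ge_min ler_pM2r ?invr_gt0//.
  by rewrite st orbT.
- split=> [t t0|s t s0 st]; first exact: sqrtr_ge0.
  by rewrite ler_wsqrtr// ler_wpM2l.
- have : Num.sqrt (2 * tau1 * t) @[t --> (0 : R)] --> Num.sqrt (2 * tau1 * 0).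
    apply: (@continuous_comp _ _ _ (fun t : R => 2 * tau1 * t) Num.sqrt).
      exact: mulrl_continuous.
    exact: sqrt_continuous.
  by rewrite mulr0 sqrtr0; exact: cvg_at_right_filter.
- by move=> t t0; rewrite mulr_gt0// lt_min ltr01 divr_gt0.
Qed.
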